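(* Let $G$ be a connected graph and let $v$ be a simplicial vertex of $G$ with $\deg(v)\geq 2$. Let $e$ be an edge incident to $v$ and let $G'=G\setminus\{e\}$. Then $$meg(G)-\deg(v)\leq meg(G')\leq meg(G)+1,$$ where $\deg(v)$ is the degree of $v$ in $G$.
   Context: Graphs are finite, undirected and simple. A simplicial vertex is a vertex whose neighbourhood induces a clique. In a connected graph $H$, an edge $e$ is monitored by a pair of vertices $x,y$ if $e$ lies on all shortest paths between $x$ and $y$. A set $M\subseteq V(H)$ is a monitoring edge-geodetic set (MEG-set) of $H$ if every edge of $H$ is monitored by some pair of vertices of $M$; $meg(H)$ is the minimum size of a MEG-set of $H$. *)

(* Defs.v *)
From mathcomp Require Import all_boot.
From mathcomp Require Import boolp.

Set Implicit Arguments.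
Unset Strict Implicit.
Unset Printing Implicit Defensive.

Record sgraph (T : finType) := SGraph {
  edge :> rel T;
  edge_sym : symmetric edge;
  edge_irrefl : irreflexive edge
}.

Section Graph.
Variables (T : finType) (G : sgraph T).

Definition connected : Prop := forall x y : T, connect G x y.

Definition nbhd (v : T) : {set T} := [set u | G v u].

Definition degree (v : T) : nat := #|nbhd v|.

Definition simplicial (v : T) : Prop :=
  forall a b : T, a \in nbhd v -> b \in nbhd v -> a != b -> G a b.

(* As in path.v, the walk x :: p is given by its origin x and its tail p;
   a walk of minimal length automatically has no repeated vertex. *)
Definition shortest_path (x y : T) (p : seq T) : Prop :=
  [/\ path G x p, last x p = y &
      forall q : seq T, path G x q -> last x q = y -> size p <= size q].

(* [zip (x :: p) p] lists the pairs of consecutive vertices of x :: p. *)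
Definition on_walk (a b x : T) (p : seq T) : bool :=
  ((a, b) \in zip (x :: p) p) || ((b, a) \in zip (x :: p) p).

(* Only meaningful for connected graphs: x and y in different components
   would vacuously monitor every edge. *)
Definition monitored (a b x y : T) : Prop :=
  forall p : seq T, shortest_path x y p -> on_walk a b x p.

Definition MEG_set (M : {set T}) : Prop :=
  forall a b : T, G a b -> exists x y : T,
    [/\ x \in M, y \in M & monitored a b x y].

Lemma MEG_setT : MEG_set [set: T].
Proof.
move=> a b ab; exists a, b; split; rewrite ?inE // => -[|c [|d p]] [].
- by move=> _ /= eab; move: ab; rewrite eab edge_irrefl.
- by move=> _ /= -> _; rewrite /on_walk /= inE eqxx.
- by move=> _ _ /(_ [:: b]); rewrite /= ab => /(_ isT erefl).
Qed.

(* The default [set: T] of arg min satisfies the predicate by MEG_setT, so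
   this is a genuine minimum (see megP). *)
Definition meg : nat :=
  #|[arg min_(M < [set: T] | `[< MEG_set M >]) #|M| ]|.

Lemma megP : (exists2 M : {set T}, MEG_set M & #|M| = meg) /\
  (forall M : {set T}, MEG_set M -> meg <= #|M|).
Proof.
rewrite /meg; case: arg_minnP => [|M /asboolP MM minM].
  exact/asboolP/MEG_setT.
by split=> [|N NN]; [exists M | apply: minM; apply/asboolP].
Qed.

Definition del_edge_rel (a b : T) : rel T := fun x y =>
  G x y && ~~ ((x == a) && (y == b) || (x == b) && (y == a)).

Lemma del_edge_sym (a b : T) : symmetric (del_edge_rel a b).
Proof.
move=> x y; rewrite /del_edge_rel edge_sym orbC.
by rewrite (andbC (y == b)) (andbC (y == a)).
Qed.

Lemma del_edge_irrefl (a b : T) : irreflexive (del_edge_rel a b).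
Proof. by move=> x; rewrite /del_edge_rel edge_irrefl. Qed.

Definition del_edge (a b : T) : sgraph T :=
  SGraph (del_edge_sym a b) (del_edge_irrefl a b).

End Graph.

(* Hence meg is meaningful for the graph obtained by deleting vu. *)
Lemma connected_del_edge (T : finType) (G : sgraph T) (v u : T) :
  connected G -> simplicial G v -> 2 <= degree G v -> G v u ->
  connected (del_edge G v u).
Proof.
move=> cG sv; rewrite /degree (cardsD1 u) inE => + vu.
rewrite vu ltnS card_gt0 => /set0Pn[w]; rewrite !inE => /andP[wu vw].
have nvw : v != w by apply: contraTneq vw => <-; rewrite edge_irrefl.
have nvu : v != u by apply: contraTneq vu => <-; rewrite edge_irrefl.
have Gwu : G w u by apply: sv; rewrite ?inE.
have symc : connect_sym (del_edge G v u).
  by apply: sym_connect_sym; apply: edge_sym.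
have cvu : connect (del_edge G v u) v u.
  apply: (@connect_trans _ _ w); apply: connect1; rewrite /= /del_edge_rel.
    by rewrite vw (negbTE wu) (negbTE nvu) /= andbF.
  by rewrite Gwu (eq_sym w v) (negbTE nvw) (negbTE wu).
move=> x y; apply: connect_sub (cG x y) => {}x {}y Gxy.
case: (boolP (del_edge G v u x y)) => [/connect1 //|].
rewrite /= /del_edge_rel Gxy /= negbK => /orP[] /andP[/eqP-> /eqP->] //.
by rewrite symc.
Qed.

(* Main.v *)
Require Import Defs.
From mathcomp Require Import all_boot.

Set Implicit Arguments.
Unset Strict Implicit.
Unset Printing Implicit Defensive.

(** A shortest path between two vertices other than a simplicial vertex [v]
    avoids [v], so [G] and [G' = G - vu] have the same shortest paths between
    such vertices, and [v] belongs to every MEG-set of either graph.  If an edge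
    other than [vw] is monitored by [v] and [y], where [w] is the second vertex
    of a shortest path from [v] to [y], then it is also monitored by [w] and
    [y].  Hence adding [u] to a MEG-set of [G] gives a MEG-set of [G'] (if
    [w <> u], the path survives in [G'] and [v], [y] still monitor the edge),
    and adding the neighbours of [v] to a MEG-set of [G'] gives a MEG-set of
    [G], the edges at [v] being monitored by their ends. *)

(** * Walks, shortest paths and monitoring in a single graph *)

Section ShortestPaths.
Variables (T : finType) (H : sgraph T).
Implicit Types (a b v w x y : T) (p q : seq T).

Lemma on_walkC a b x p : on_walk a b x p = on_walk b a x p.
Proof. by rewrite /on_walk orbC. Qed.

Lemma on_walk_cons a b x c p :
  on_walk a b x (c :: p) =
  (a == x) && (b == c) || (b == x) && (a == c) || on_walk a b c p.
Proof. by rewrite /on_walk /= !inE !xpair_eqE orbACA. Qed.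

Lemma on_walk_rcons a b x c p :
  on_walk a b x (rcons p c) =
  on_walk a b x p ||
  ((a == last x p) && (b == c) || (b == last x p) && (a == c)).
Proof.
by elim: p x => [|d p IHp] x; rewrite /= !on_walk_cons ?IHp ?orbA ?orbF.
Qed.

(** A walk is stored as an origin and a tail, so reversing [x :: p] gives the origin [last x p] and
    the tail [rev (belast x p)]. *)
Lemma on_walk_rev a b x p :
  on_walk a b (last x p) (rev (belast x p)) = on_walk a b x p.
Proof.
elim: p x => [|c p IHp] x //=.
rewrite rev_cons on_walk_rcons IHp on_walk_cons orbC; congr (_ || _).
have -> : last (last c p) (rev (belast c p)) = c.
  by case: p {IHp} => //= d p; rewrite rev_cons last_rcons.
by rewrite orbC andbC (andbC (a == c)).
Qed.

Lemma on_walk_mem a b x p : on_walk a b x p -> a \in x :: p.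
Proof.
elim: p x => [|c p IHp] x //; rewrite on_walk_cons inE.
case/orP=> [/orP[/andP[->] //|/andP[_ /eqP->]]|/IHp->]; last by rewrite orbT.
by rewrite !inE eqxx orbT.
Qed.

(** Strong induction on the length: a walk that is not shortest has a strictly shorter
    competitor. *)
Lemma shortest_pathP x y p :
  path H x p -> last x p = y -> exists q, shortest_path H x y q.
Proof.
have [n] := ubnP (size p); elim: n p => // n IHn p /ltnSE le_p_n pth lst.
have [[q [qth qlst lt_qp]]|minp] := boolp.pselect
  (exists q, [/\ path H x q, last x q = y & size q < size p]).
  exact: IHn (leq_trans lt_qp le_p_n) qth qlst.
exists p; split=> // q qth qlst; rewrite leqNgt; apply/negP => lt_qp.
by apply: minp; exists q.
Qed.

Lemma connected_shortest_path x y :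
  connected H -> exists p, shortest_path H x y p.
Proof.
by move=> /(_ x y) /connectP[p pth lst]; apply: (shortest_pathP pth).
Qed.

Lemma shortest_path_rev x y p :
  shortest_path H x y p -> shortest_path H y x (rev (belast x p)).
Proof.
have revP z q : path H (last z q) (rev (belast z q)) = path H z q.
  by rewrite rev_path; apply: eq_path => s t; rewrite /= edge_sym.
have lastP z q : last (last z q) (rev (belast z q)) = z.
  by case: q => //= c q; rewrite rev_cons last_rcons.
move=> [pth lst minp]; split; first by rewrite -lst revP.
  by rewrite -lst lastP.
move=> q qth qlst; rewrite size_rev size_belast -(size_belast y q).
by rewrite -(size_rev (belast y q)); apply: minp; rewrite -qlst ?revP ?lastP.
Qed.

Lemma monitored_sym a b x y : monitored H a b x y -> monitored H a b y x.
Proof.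
move=> mon p sp; have := mon _ (shortest_path_rev sp).
by case: sp => _ <- _; rewrite on_walk_rev.
Qed.

Lemma monitoredC a b x y : monitored H a b x y -> monitored H b a x y.
Proof. by move=> mon p /mon; rewrite on_walkC. Qed.

Lemma not_monitored_refl a b x : ~ monitored H a b x x.
Proof. by move=> /(_ [::]) mon; have : on_walk a b x [::] by apply: mon. Qed.

Lemma edge_monitored a b : H a b -> monitored H a b a b.
Proof.
move=> ab [|c [|d p]] [].
- by move=> _ /= eab; rewrite eab edge_irrefl in ab.
- by move=> _ /= -> _; rewrite on_walk_cons !eqxx.
- by move=> _ _ /(_ [:: b]); rewrite /= ab => /(_ isT erefl).
Qed.

Lemma shortest_path_behead x y w p q :
  shortest_path H x y (w :: p) -> shortest_path H w y q ->
  shortest_path H x y (w :: q).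
Proof.
move=> [/= /andP[xw pth] lst minp] [qth qlst minq].
split=> //=; first by rewrite xw.
by move=> r rth rlst; apply: leq_trans (minp r rth rlst); apply: minq.
Qed.

Lemma shortest_path_tail x y w p :
  shortest_path H x y (w :: p) -> shortest_path H w y p.
Proof.
move=> [/= /andP[xw pth] lst minp]; split=> // q qth qlst.
by apply: (minp (w :: q)); rewrite //= xw.
Qed.

(** Prefixing [x] to any shortest path from [w] to [y] gives a shortest path from [x] to [y]; the
    monitored edge lies on it and is not its first edge. *)
Lemma monitored_behead a b x y w p :
  shortest_path H x y (w :: p) -> monitored H a b x y ->
  ~~ ((a == x) && (b == w) || (b == x) && (a == w)) -> monitored H a b w y.
Proof.
move=> sp mon nab q /(shortest_path_behead sp) /mon.
by rewrite on_walk_cons (negbTE nab).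
Qed.

(** The predecessor and the successor of [v] on such a path would be neighbours of [v], hence equal
    or adjacent, and skipping [v] would shorten the path. *)
Lemma simplicial_avoid v x y p :
  simplicial H v -> x != v -> y != v -> shortest_path H x y p -> v \notin p.
Proof.
move=> sv xv yv [pth lst minp]; apply/negP => vp.
case/splitPr: vp pth lst minp => p1 [|c p2].
  by rewrite last_cat /= => _ yE; rewrite yE eqxx in yv.
rewrite cat_path last_cat /= => /and4P[pth1 av vc pth2] lst minp.
have [ac|nac] := eqVneq (last x p1) c.
  have := minp (p1 ++ p2); rewrite cat_path last_cat ac pth1 pth2 lst.
  by move=> /(_ isT erefl); rewrite !size_cat /= leq_add2l ltnNge leqnSn.
have Hac : H (last x p1) c by apply: sv; rewrite // inE // edge_sym.
have := minp (p1 ++ c :: p2); rewrite cat_path last_cat /= pth1 Hac pth2 lst.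
by move=> /(_ isT erefl); rewrite !size_cat /= leq_add2l ltnn.
Qed.

(** By [simplicial_avoid], only a pair containing [v] can monitor the edge [vw]. *)
Lemma MEG_simplicial v w (M : {set T}) :
  connected H -> simplicial H v -> H v w -> MEG_set H M -> v \in M.
Proof.
move=> cH sv vw MM; have [x [y [xM yM mon]]] := MM _ _ vw.
have [<- //|xv] := eqVneq x v; have [<- //|yv] := eqVneq y v.
have [p sp] := connected_shortest_path x y cH.
have := on_walk_mem (mon p sp); rewrite inE eq_sym (negbTE xv) /=.
by rewrite (negbTE (simplicial_avoid sv xv yv sp)).
Qed.

End ShortestPaths.

(** * Two graphs that differ only in edges at a common simplicial vertex *)

Section AgreeOff.
Variables (T : finType) (H K : sgraph T) (v : T).
Hypotheses (sHv : simplicial H v) (sKv : simplicial K v).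
Hypothesis eqHK : forall a b, a != v -> b != v -> H a b = K a b.

Lemma path_agree x p : x != v -> v \notin p -> path H x p = path K x p.
Proof.
elim: p x => //= c p IHp x xv; rewrite inE negb_or eq_sym => /andP[cv vp].
by rewrite eqHK // IHp.
Qed.

Lemma shortest_path_agree x y p :
  x != v -> y != v -> shortest_path H x y p -> shortest_path K x y p.
Proof.
move=> xv yv sp; have vp := simplicial_avoid sHv xv yv sp.
case: sp => pth lst minp; split=> // [|q qth qlst]; first by rewrite -path_agree.
(* The competitor [q] may visit [v]; a shortest path [r] of [K] does not, so it is also a walk of
   [H] and can be compared with [p]. *)
have [r sr] := shortest_pathP qth qlst.
have vr := simplicial_avoid sKv xv yv sr.
case: sr => rth rlst /(_ q qth qlst); apply: leq_trans.
by apply: minp; rewrite ?path_agree.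
Qed.

End AgreeOff.

Lemma monitored_agree (T : finType) (H K : sgraph T) (v a b x y : T) :
  simplicial H v -> simplicial K v ->
  (forall s t, s != v -> t != v -> H s t = K s t) ->
  x != v -> y != v -> monitored H a b x y -> monitored K a b x y.
Proof.
move=> sH sK eqHK xv yv mon p sp; apply: mon.
by apply: (shortest_path_agree sK sH) sp => // s t sv tv; rewrite eqHK.
Qed.

(** * Transfer of MEG-sets between [G] and [G'] *)

Section DeleteEdge.
Variables (T : finType) (G : sgraph T) (v u : T).
Hypotheses (cG : connected G) (sv : simplicial G v) (dv : 2 <= degree G v).
Hypothesis vu : G v u.
Let G' := del_edge G v u.

Let eqGG' s t : s != v -> t != v -> G s t = G' s t.
Proof.
move=> sv0 tv; rewrite /G' /= /del_edge_rel.
by rewrite (negbTE sv0) (negbTE tv) andbF andbT.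
Qed.

Let eqG'G s t : s != v -> t != v -> G' s t = G s t.
Proof. by move=> *; rewrite eqGG'. Qed.

Let subG' s t : G' s t -> G s t.
Proof. by case/andP. Qed.

Let neq_adj w : G v w -> w != v.
Proof. by apply: contraTneq => ->; rewrite edge_irrefl. Qed.

(** The deleted edge contains [v], so it joins no two neighbours of [v]. *)
Lemma simplicial_del_edge : simplicial G' v.
Proof.
move=> a b; rewrite !inE => /subG' va /subG' vb ab.
by rewrite eqG'G ?neq_adj //; apply: sv; rewrite ?inE.
Qed.
Let sv' := simplicial_del_edge.

Let cG' : connected G' := connected_del_edge cG sv dv vu.

Lemma MEG_set_del_edge (M : {set T}) : MEG_set G M -> MEG_set G' (u |: M).
Proof.
move=> MM a b ab'.
(* Only pairs containing [v] need care; [v] is either replaced by [u] or kept, according to the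
   first step [w] of a shortest path. *)
have from_v y : y \in M -> monitored G a b v y ->
    exists2 x, x \in u |: M & monitored G' a b x y.
  move=> yM mon.
  have yv : y != v by apply: contraPneq mon => ->; apply: not_monitored_refl.
  have [[|w p] sp] := connected_shortest_path v y cG; first by have := mon _ sp.
  have vw : G v w by case: sp => /andP[].
  have [wu|wu] := eqVneq w u.
    exists u; first exact: setU11.
    apply: (monitored_agree sv) => //; first exact: neq_adj.
    rewrite wu in sp; apply: monitored_behead sp mon _.
    (* As an edge of [G'], [ab] is not the deleted edge [vu]. *)
    by case/andP: ab' => _; rewrite (andbC (a == u)).
  exists v.
    by rewrite inE; have := MEG_simplicial cG sv vu MM => ->; rewrite orbT.
  (* The path through [w] survives in [G'], so [v] and [y] are as far apart in
     [G'] as in [G]. *)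
  have wp' : path G' v (w :: p).
    have vp := simplicial_avoid sv (neq_adj vw) yv (shortest_path_tail sp).
    case: sp => /= /andP[_ pth] _ _; rewrite -(path_agree eqGG') ?neq_adj //.
    by rewrite pth /del_edge_rel vw (negbTE wu) (negbTE (neq_adj vw)) !andbF.
  move=> q [qth qlst minq]; apply: mon; split=> // [|r rth rlst].
    exact: sub_path qth.
  case: sp => _ lst minp; apply: leq_trans (minp r rth rlst).
  exact: minq.
have [x [y [xM yM mon]]] := MM _ _ (subG' ab').
have [xv|xv] := eqVneq x v.
  rewrite xv in mon; have [z zM zmon] := from_v y yM mon.
  by exists z, y; split=> //; rewrite inE yM orbT.
have [yv|yv] := eqVneq y v.
  rewrite yv in mon; have [z zM zmon] := from_v x xM (monitored_sym mon).
  by exists z, x; split=> //; rewrite inE xM orbT.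
exists x, y; rewrite !inE xM yM !orbT; split=> //.
exact: (monitored_agree sv sv' eqGG').
Qed.

Lemma MEG_set_undel_edge (M : {set T}) :
  MEG_set G' M -> MEG_set G (nbhd G v :|: M).
Proof.
move=> MM.
have vM : v \in M.
  (* Since [v] has degree at least 2, some edge [vw] with [w] other than [u] survives in [G'] and
     forces [v] into [M]. *)
  have : 0 < #|nbhd G v :\ u|.
    by move: dv; rewrite /degree (cardsD1 u) inE vu.
  rewrite card_gt0 => /set0Pn[w]; rewrite !inE => /andP[wu vw].
  apply: (MEG_simplicial cG' sv' (w := w)) => //=.
  by rewrite /del_edge_rel vw (negbTE wu) (negbTE (neq_adj vw)) !andbF.
move=> a b ab.
(* Edges at [v], the deleted one included, have both ends in the enlarged set. *)
have [av|av] := eqVneq a v.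
  rewrite av in ab *; exists v, b; rewrite !inE vM ab orbT.
  by split=> //; apply: edge_monitored.
have [bv|bv] := eqVneq b v.
  rewrite bv edge_sym in ab *; exists v, a; rewrite !inE vM ab orbT.
  by split=> //; apply/monitoredC/edge_monitored.
have from_v y : y \in M -> monitored G' a b v y ->
    exists2 x, x \in nbhd G v :|: M & monitored G a b x y.
  move=> yM mon.
  have yv : y != v by apply: contraPneq mon => ->; apply: not_monitored_refl.
  have [[|w p] sp] := connected_shortest_path v y cG'; first by have := mon _ sp.
  have vw : G v w by case: sp => /andP[/subG'].
  exists w; first by rewrite !inE vw.
  apply: (monitored_agree sv' sv eqG'G) => //; first exact: neq_adj.
  (* Neither end of [ab] is [v], so [ab] is not the first edge [vw]. *)
  by apply: monitored_behead sp mon _; rewrite (negbTE av) (negbTE bv).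
have ab' : G' a b by rewrite eqG'G.
have [x [y [xM yM mon]]] := MM _ _ ab'.
have [xv|xv] := eqVneq x v.
  rewrite xv in mon; have [z zM zmon] := from_v y yM mon.
  by exists z, y; split=> //; rewrite inE yM orbT.
have [yv|yv] := eqVneq y v.
  rewrite yv in mon; have [z zM zmon] := from_v x xM (monitored_sym mon).
  by exists z, x; split=> //; rewrite inE xM orbT.
exists x, y; rewrite !inE xM yM !orbT; split=> //.
exact: (monitored_agree sv' sv eqG'G).
Qed.

End DeleteEdge.

(* Truncated subtraction is harmless: meg (del_edge G v u) >= 0. *)
Theorem theorem4p13 (T : finType) (G : sgraph T) (v u : T)
  (G_connected : connected G)
  (v_simplicial : simplicial G v)
  (v_degree : 2 <= degree G v)
  (vu_edge : G v u) :
  meg G - degree G v <= meg (del_edge G v u) /\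
  meg (del_edge G v u) <= meg G + 1.
Proof.
have [[M MM <-] minM] := megP G.
have [[M' MM' <-] minM'] := megP (del_edge G v u).
split.
  rewrite leq_subLR; apply: leq_trans (leq_card_setU _ _).
  by apply: minM; apply: MEG_set_undel_edge MM'.
apply: leq_trans (minM' _ (MEG_set_del_edge _ _ vu_edge MM)) _ => //.
(* The set grows by at most one, as [u] may already lie in [M]. *)
by rewrite cardsU1 addnC leq_add2l leq_b1.
Qed.
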